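(* Let $\mathcal{G}$ be a DAG on node set $[p]$ with $i\to j\in\mathcal{G}$. If $\mathcal{G}_{i\leftarrow j}$ is a DAG, then either $\mathcal{G}$ and $\mathcal{G}_{i\leftarrow j}$ are Markov equivalent, or $\{\mathcal{G},\mathcal{G}_{i\leftarrow j}\}$ is a turn pair.
   Context: All graphs are simple and $[p]=\{1,\dots,p\}$. A DAG is a directed acyclic graph. The skeleton of a directed graph is the undirected graph obtained by forgetting the directions of the edges. For a DAG $\mathcal{G}$ let $\operatorname{pa}_{\mathcal{G}}(i)=\{k\colon k\to i\in\mathcal{G}\}$; for an undirected graph $G$ let $\operatorname{ne}_G(i)$ be the set of neighbors of $i$ in $G$. If $i\to j\in\mathcal{G}$, then $\mathcal{G}_{i\leftarrow j}$ denotes the directed graph identical to $\mathcal{G}$ except that the edge $i\to j$ is replaced with $i\leftarrow j$. Markov equivalence: two DAGs on $[p]$ are Markov equivalent if they encode the same set of conditional independence statements, where a DAG $\mathcal{G}$ encodes the statements entailed by $X_i\perp X_{\operatorname{nd}_{\mathcal{G}}(i)\setminus\operatorname{pa}_{\mathcal{G}}(i)}\mid X_{\operatorname{pa}_{\mathcal{G}}(i)}$ for $i\in[p]$, with $\operatorname{nd}_{\mathcal{G}}(i)$ the non-descendants of $i$ (the nodes other than $i$ that are not reachable from $i$ by a directed path). By a classical theorem of Verma and Pearl, this holds if and only if the two DAGs have the same skeleton and the same v-structures (induced subgraphs $a\to b\leftarrow c$); by a theorem of Studený, Hemmecke and Lindner it holds if and only if their characteristic imsets (defined next) are equal. Characteristic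 imset: for a DAG $\mathcal{G}$ on $[p]$, $c_{\mathcal{G}}\colon\{S\subseteq[p]\colon|S|\ge 2\}\to\{0,1\}$ is given by $c_{\mathcal{G}}(S)=1$ if there exists $i\in S$ such that $j\in\operatorname{pa}_{\mathcal{G}}(i)$ for all $j\in S\setminus\{i\}$, and $c_{\mathcal{G}}(S)=0$ otherwise. It is identified with a vector in $\mathbb{R}^{2^p-p-1}$ with standard basis vectors $e_S$ indexed by the sets $S\subseteq[p]$, $|S|\geq 2$. Turn pair: let $\mathcal{G}$ and $\mathcal{H}$ be two DAGs on node set $[p]$ with (the same) skeleton $G$. Suppose there exist $i$, $j$, $S_i\subseteq[p]\setminus\{i,j\}$ and $S_j\subseteq[p]\setminus\{i,j\}$ such that (1) $c_{\mathcal{G}}(\{i,j\})=1$ (in particular $i\ne j$); (2) $c_{\mathcal{G}}(S\cup\{i\})=1$ for all $S\subseteq S_i$ with $|S|\ge1$; (3) $c_{\mathcal{G}}(S\cup\{j\})=1$ for all $S\subseteq S_j$ with $|S|\ge1$; (4) either $S_i\not\subseteq\operatorname{ne}_G(j)$ or $S_j\not\subseteq\operatorname{ne}_G(i)$ (inclusive or). Then $\{\mathcal{G},\mathcal{H}\}$ is a turn pair (with respect to $(i,j,S_i,S_j)$) if $$c_{\mathcal{H}}=c_{\mathcal{G}}+\sum_{S\in\mathcal{S}^+}e_S-\sum_{S\in\mathcal{S}^-}e_S,$$ where $\mathcal{S}^+=\{T\cup\{i,j\}\colon T\subseteq S_i,\ T\not\subseteq\operatorname{ne}_G(j)\}$ and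 $\mathcal{S}^-=\{T\cup\{i,j\}\colon T\subseteq S_j,\ T\not\subseteq\operatorname{ne}_G(i)\}$. *)

(* Defs.v *)
From HB Require Import structures.
From mathcomp Require Import all_boot all_order all_algebra.
From mathcomp Require Import all_classical all_reals all_analysis.

Set Implicit Arguments.
Unset Strict Implicit.
Unset Printing Implicit Defensive.

Import Order.TTheory GRing.Theory Num.Theory.

Local Open Scope ring_scope.

Section DirectedGraphs.
Variable p : nat.
Implicit Types (G : rel 'I_p) (i j a b : 'I_p).

(* Loops and pairs of opposite edges are cycles of length 1 and 2, so a DAG is
   simple. *)
Definition is_dag G : Prop := forall s : seq 'I_p, cycle G s -> s = [::].

Definition skeleton G : rel 'I_p := fun a b => G a b || G b a.

Definition pa G i : {set 'I_p} := [set k | G k i]%SET.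

Definition ne (e : rel 'I_p) i : {set 'I_p} := [set k | e i k]%SET.

Definition nd G i : {set 'I_p} := [set k | (k != i) && ~~ connect G i k]%SET.

Definition reverse_edge G i j : rel 'I_p := fun a b =>
  ((a == j) && (b == i)) || (G a b && ~~ ((a == i) && (b == j))).

End DirectedGraphs.

Section ConditionalIndependence.
Context {d : measure_display} {Omega : measurableType d} {R : realType}.
Variable P : probability Omega R.
Local Open Scope classical_set_scope.

(* g is a version of the conditional probability P(E | F), where F is a
   sub-sigma-algebra of the measurable sets. *)
Definition is_cond_prob (F : set (set Omega)) (E : set Omega)
    (g : Omega -> R) : Prop :=
  [/\ forall B : set R, measurable B -> F (g @^-1` B),
      P.-integrable setT (EFin \o g) &
      forall C, F C -> (\int[P]_(w in C) (g w)%:E = P (E `&` C))%E].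

(* P(E1 /\ E2 | F) = P(E1 | F) P(E2 | F) almost surely, for E1 in F1 and
   E2 in F2.  Versions of these conditional probabilities exist by
   Radon-Nikodym and are almost surely unique. *)
Definition sigma_cond_indep (F1 F2 F : set (set Omega)) : Prop :=
  forall (E1 E2 : set Omega) (g1 g2 g12 : Omega -> R), F1 E1 -> F2 E2 ->
    is_cond_prob F E1 g1 -> is_cond_prob F E2 g2 ->
    is_cond_prob F (E1 `&` E2) g12 ->
    {ae P, forall w, g12 w = g1 w * g2 w}.

Context {p : nat} {d' : 'I_p -> measure_display}
  {T : forall k, measurableType (d' k)}.
Variable X : forall k, {RV P >-> T k}.

Definition sigma_of (A : {set 'I_p}) : set (set Omega) :=
  <<s \bigcup_(k in [set` A]) preimage_set_system setT (X k) measurable >>.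

Definition cond_indep (A B C : {set 'I_p}) : Prop :=
  sigma_cond_indep (sigma_of A) (sigma_of B) (sigma_of C).

Definition local_markov (G : rel 'I_p) : Prop :=
  forall i, cond_indep [set i]%SET (nd G i :\: pa G i)%SET (pa G i).

End ConditionalIndependence.

Section MarkovEquivalence.
Variables (R : realType) (p : nat).

(* G encodes "X_A and X_B are independent given X_C".  Entailment is semantic:
   it ranges over all random vectors, with arbitrary measurable state
   spaces. *)
Definition encodes (G : rel 'I_p) (A B C : {set 'I_p}) : Prop :=
  [/\ [disjoint A & B], [disjoint A & C], [disjoint B & C] &
    forall (d : measure_display) (Omega : measurableType d)
      (P : probability Omega R) (d' : 'I_p -> measure_display)
      (T : forall k, measurableType (d' k)) (X : forall k, {RV P >-> T k}),
      local_markov X G -> cond_indep X A B C].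

Definition markov_equiv (G H : rel 'I_p) : Prop :=
  forall A B C, encodes G A B C <-> encodes H A B C.

End MarkovEquivalence.

Section CharacteristicImsets.
Variables (R : realType) (p : nat).
Implicit Types (G H : rel 'I_p) (S T : {set 'I_p}).

Definition imset_index := {S : {set 'I_p} | (1 < #|S|)%N}.

Definition char_imset G : {ffun imset_index -> R} :=
  [ffun S : imset_index =>
    [exists i in val S, forall j in (val S :\ i)%SET, j \in pa G i]%:R].

(* The S-coordinate of c, with value 0 when #|S| < 2. *)
Definition imset_coord (c : {ffun imset_index -> R}) S : R :=
  if insub S is Some A then c A else 0.

Definition imset_basis S : {ffun imset_index -> R} :=
  [ffun A : imset_index => (val A == S)%:R].

Definition turn_plus (e : rel 'I_p) (i j : 'I_p) (Si : {set 'I_p}) :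
    {set {set 'I_p}} :=
  [set (T :|: [set i; j]) | T : {set 'I_p}
    in [pred T : {set 'I_p} | (T \subset Si) && ~~ (T \subset ne e j)]]%SET.

Definition turn_minus (e : rel 'I_p) (i j : 'I_p) (Sj : {set 'I_p}) :
    {set {set 'I_p}} :=
  [set (T :|: [set i; j]) | T : {set 'I_p}
    in [pred T : {set 'I_p} | (T \subset Sj) && ~~ (T \subset ne e i)]]%SET.

(* i != j follows from the second conjunct: imset_coord is 0 on singletons. *)
Definition turn_pair_wrt G H (i j : 'I_p) (Si Sj : {set 'I_p}) : Prop :=
  let e := skeleton G in
  let c := char_imset G in
  [/\ Si \subset (~: [set i; j])%SET /\ Sj \subset (~: [set i; j])%SET,
      imset_coord c [set i; j]%SET = 1,
      (forall S, S \subset Si -> (1 <= #|S|)%N ->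
         imset_coord c (S :|: [set i])%SET = 1) /\
      (forall S, S \subset Sj -> (1 <= #|S|)%N ->
         imset_coord c (S :|: [set j])%SET = 1),
      ~~ (Si \subset ne e j) \/ ~~ (Sj \subset ne e i) &
      char_imset H = c + \sum_(S in turn_plus e i j Si) imset_basis S
                       - \sum_(S in turn_minus e i j Sj) imset_basis S].

(* This is symmetric in G and H: exchange i with j and Si with Sj. *)
Definition turn_pair G H : Prop :=
  [/\ is_dag G, is_dag H, skeleton G =2 skeleton H &
      exists i j Si Sj, turn_pair_wrt G H i j Si Sj].

End CharacteristicImsets.

(* Main.v *)
(* Write H for the reversal of the edge i -> j.  If pa(j) differs from
   pa(i) + i, then S_i = pa(i) and S_j = pa(j) - i witness a turn pair: as G
   and H are acyclic, a subset of pa(i) lies in ne(j) iff it lies in pa(j), and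
   conversely, so that S+ and S- are exactly the sets which gain, respectively
   lose, a sink.

   Otherwise i -> j is covered, and the local Markov properties of G and H are
   equivalent for every random vector.  This uses the semigraphoid rules, which
   become immediate once A _||_ B | C is restated as: every event of sigma(A)
   has a single function as conditional probability both given sigma(C) and
   given sigma(B + C).  The rules turn i _||_ W | pa(i) and j _||_ W | pa(i) + i
   into the statement for j in H, where W is the set of non-descendants of j in
   H; the statement for i in H follows by adding to W + j the other
   non-descendants of i one by one, parents first. *)
Require Import Defs.
From HB Require Import structures.
From mathcomp Require Import all_boot all_order all_algebra.
From mathcomp Require Import all_classical all_reals all_analysis.
From mathcomp Require Import measurable_realfun.

Set Implicit Arguments.
Unset Strict Implicit.
Unset Printing Implicit Defensive.

Import Order.TTheory GRing.Theory Num.Theory.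

Local Open Scope ring_scope.

(** * Conditional independence of sigma-algebras *)

Section SigmaAlgebras.
Local Open Scope classical_set_scope.

(** * Restriction of a probability to a sub-sigma-algebra *)

Section SubSigmaAlgebra.
Context {d : measure_display} {Omega : measurableType d} {R : realType}.
Variable P : probability Omega R.

Definition sub_sigma (F : set (set Omega)) : Prop :=
  sigma_algebra setT F /\ F `<=` measurable.

Definition coarse_measurable (F : set (set Omega)) (g : Omega -> R) : Prop :=
  forall B : set R, measurable B -> F (g @^-1` B).

Section Coarse.
Variable F : set (set Omega).
Hypothesis sF : sub_sigma F.

(** This turns [F]-measurability into ordinary measurability, so that general theorems on integrals
    and densities apply to [F]. *)
Let coarse : measurableType (sigma_display F) := g_sigma_algebraType F.

Lemma coarse_measurableE (A : set coarse) : measurable A = F A.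
Proof. by rewrite /measurable/= sigma_algebra_id//; case: sF. Qed.

Lemma measurable_fun_coarse (g : Omega -> R) :
  coarse_measurable F g <-> measurable_fun (setT : set coarse) (g : coarse -> R).
Proof.
split=> [mg _ B mB|mg B mB]; first by rewrite setTI coarse_measurableE; exact: mg.
by rewrite -coarse_measurableE -[X in measurable X]setTI; exact: mg.
Qed.

Lemma measurable_fun_to_coarse :
  measurable_fun (setT : set Omega) (idfun : Omega -> coarse).
Proof. by move=> _ B; rewrite coarse_measurableE setTI => /sF.2. Qed.

Lemma coarse_measurableW (g : Omega -> R) :
  coarse_measurable F g -> measurable_fun setT g.
Proof. by move=> mg _ B mB; rewrite setTI; apply: sF.2; exact: mg. Qed.

Section Trace.
Variable E : set Omega.
Hypothesis mE : measurable E.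

(** The case [E = setT] is the restriction of [P] to [F]; the density of the general case with
    respect to it is the conditional probability of [E]. *)
Definition trace (A : set coarse) : \bar R := P (E `&` A).

Let trace0 : trace set0 = 0%E.
Proof. by rewrite /trace setI0 measure0. Qed.

Let trace_ge0 A : (0 <= trace A)%E.
Proof. exact: measure_ge0. Qed.

Let trace_sigma_additive : semi_sigma_additive trace.
Proof.
move=> A mA tA _; rewrite /trace setI_bigcupr.
apply: measure_semi_sigma_additive.
- move=> n; apply: measurableI => //; apply: sF.2.
  by rewrite -coarse_measurableE; exact: mA.
- apply/trivIsetP => /= i j _ _ ij; rewrite setIACA setIid.
  by move/trivIsetP : tA => /(_ _ _ _ _ ij) ->//; rewrite setI0.
- apply: bigcupT_measurable => n; apply: measurableI => //; apply: sF.2.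
  by rewrite -coarse_measurableE; exact: mA.
Qed.

HB.instance Definition _ := isMeasure.Build _ _ _
  trace trace0 trace_ge0 trace_sigma_additive.

Let trace_fin : fin_num_fun trace.
Proof.
move=> A; rewrite coarse_measurableE => /sF.2 mA.
by apply: fin_num_measure; exact: measurableI.
Qed.

HB.instance Definition _ := Measure_isFinite.Build _ _ _ trace trace_fin.

Definition trace_measure : {finite_measure set coarse -> \bar R} := trace.

Lemma ge0_integral_trace (C : set coarse) (f : coarse -> \bar R) :
  F C -> measurable_fun setT f -> (forall w, 0 <= f w)%E ->
  (\int[trace_measure]_(w in C) f w = \int[P]_(w in E `&` C) f w)%E.
Proof.
move=> FC mf f0.
have mf' : measurable_fun (setT : set Omega) f.
  exact: (measurableT_comp mf measurable_fun_to_coarse).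
have mC := sF.2 _ FC.
(* The trace is the image of [P] restricted to [E] under the identity map into the coarse space. *)
transitivity (\int[pushforward (mrestr P mE) (idfun : Omega -> coarse)]_(w in C)
  f w)%E.
  apply: eq_measure_integral => [|mid A mA AC]; first exact: measurable_fun_to_coarse.
  by transitivity (P (E `&` A)) => //; rewrite setIC.
have mCc : (sigma_display F).-measurable C by rewrite coarse_measurableE.
rewrite (ge0_integral_pushforward measurable_fun_to_coarse _ mCc) //; last first.
  exact: measurable_funTS.
rewrite (_ : _ @^-1` C = C) //.
(* The complement of [E] is null for the restricted measure, which agrees with [P] on subsets of
   [E]. *)
rewrite (@ge0_negligible_integral _ _ _ (mrestr P mE) C (~` E) f) //; first last.
- by transitivity (P (~` E `&` E)); rewrite // setICl measure0.
- exact: measurable_funTS.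
- exact: measurableC.
rewrite setDE setCK setIC.
apply: eq_measure_integral => A mA AEC.
by congr (P _); apply: setIidl => x /AEC[].
Qed.

End Trace.
End Coarse.
End SubSigmaAlgebra.

(** * Conditional probabilities given a sub-sigma-algebra *)

Section CondProb.
Context {d : measure_display} {Omega : measurableType d} {R : realType}.
Variable P : probability Omega R.

Section Version.
Variable F : set (set Omega).
Hypothesis sF : sub_sigma F.
Local Notation coarse := (g_sigma_algebraType F).

Lemma integral_trace (E : set Omega) (mE : measurable E) (C : set coarse)
    (f : coarse -> \bar R) :
  F C -> measurable_fun setT f ->
  (\int[trace_measure P sF mE]_(w in C) f w = \int[P]_(w in E `&` C) f w)%E.
Proof.
move=> FC mf; rewrite integralE [RHS]integralE; congr (_ - _)%E.
  by apply: ge0_integral_trace => //; exact: measurable_funepos.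
by apply: ge0_integral_trace => //; exact: measurable_funeneg.
Qed.

(** Under the restriction of [P] to [F], equal integrals over all measurable sets force almost sure
    equality; the null set obtained lies in [F] and is also null for [P]. *)
Lemma coarse_ae_eq (u v : Omega -> R) :
  coarse_measurable F u -> coarse_measurable F v ->
  P.-integrable setT (EFin \o u) ->
  (forall C, F C -> \int[P]_(w in C) (u w)%:E = \int[P]_(w in C) (v w)%:E)%E ->
  {ae P, forall w, u w = v w}.
Proof.
move=> /(measurable_fun_coarse sF) mu /(measurable_fun_coarse sF) mv iu uv.
pose tr := trace_measure P sF measurableT.
have : ae_eq tr setT (EFin \o u : coarse -> \bar R) (EFin \o v).
  apply: integral_ae_eq => //.
  - apply/integrableP; split; first exact/measurable_EFinP.
    rewrite /tr integral_trace//.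
    + by rewrite setTI; case/integrableP : iu.
    + by rewrite -coarse_measurableE//; exact: measurableT.
    + apply: measurableT_comp => //; exact/measurable_EFinP.
  - exact/measurable_EFinP.
  - move=> C _; rewrite coarse_measurableE// => FC.
    rewrite /tr !integral_trace ?setTI//; [exact: uv|exact/measurable_EFinP..].
move=> [N [mN N0 sN]]; exists N; split => //.
- by apply: sF.2; rewrite -coarse_measurableE.
- by rewrite -N0 -[in LHS](setTI N).
- move=> w /= uvw; apply: sN => /= H; apply: uvw.
  by have [] := H I.
Qed.

(* The last clause is the pull-out property of conditional expectations. *)
Lemma cond_prob_exists (E : set Omega) : measurable E -> exists g : Omega -> R,
  [/\ is_cond_prob P F E g, forall w, 0 <= g w &
   forall (C : set Omega) (f : Omega -> R), F C -> coarse_measurable F f ->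
     (forall w, 0 <= f w) ->
     (\int[P]_(w in C) (f w * g w)%:E = \int[P]_(w in E `&` C) (f w)%:E)%E].
Proof.
move=> mE; pose nu := trace_measure P sF mE.
pose mu := trace_measure P sF measurableT.
have numu : nu `<< mu.
  apply/null_content_dominatesP => A; rewrite coarse_measurableE// => FA muA.
  have PA : P A = 0%E by rewrite -muA -[in LHS](setTI A).
  have mA := sF.2 _ FA.
  apply/eqP; rewrite eq_le; apply/andP; split; last exact: measure_ge0.
  by rewrite -PA; apply: le_measure; rewrite ?inE//; exact: measurableI.
(* The version is the density of the trace of [E] with respect to [P] on [F]; its change of
   variables formula is the pull-out property. *)
pose h : coarse -> \bar R := Radon_Nikodym_SigmaFinite.f nu mu.
have h0 : forall w, (0 <= h w)%E := Radon_Nikodym_SigmaFinite.f_ge0 numu.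
have hfin : forall w, h w \is a fin_num := Radon_Nikodym_SigmaFinite.f_fin_num numu.
have hint : mu.-integrable setT h := Radon_Nikodym_SigmaFinite.f_integrable numu.
have mh := measurable_int _ hint.
pose g : Omega -> R := fine \o h.
have gh w : (g w)%:E = h w by rewrite /g /= fineK.
have mg : coarse_measurable F g.
  by apply/measurable_fun_coarse => //; exact: measurableT_comp mh.
have FT : F setT by rewrite -coarse_measurableE//; exact: measurableT.
have ig C : F C -> (\int[P]_(w in C) (g w)%:E = P (E `&` C))%E.
  move=> FC; under eq_integral do rewrite gh.
  rewrite -[C in LHS]setTI -(integral_trace measurableT)//.
  rewrite -(Radon_Nikodym_SigmaFinite.f_integral numu)//.
  by rewrite coarse_measurableE.
exists g; split => //.
- split => //; apply/integrableP; split.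
    by apply/measurable_EFinP; exact: (coarse_measurableW sF).
  rewrite (eq_integral (fun w => (g w)%:E)); last first.
    by move=> w _; rewrite gee0_abs//= gh.
  by rewrite ig// setIT (le_lt_trans (probability_le1 P mE))// ltry.
- by move=> w; rewrite -lee_fin gh.
- move=> C f FC /(measurable_fun_coarse sF) mf f0.
  under eq_integral do rewrite EFinM gh.
  have mfE : measurable_fun (setT : set coarse) (EFin \o f : coarse -> \bar R).
    exact/measurable_EFinP.
  rewrite -[C in LHS]setTI -(integral_trace measurableT)//; last first.
    exact: emeasurable_funM.
  rewrite (Radon_Nikodym_SigmaFinite.change_of_variables numu (f := EFin \o f))//.
  + by rewrite integral_trace.
  + by rewrite coarse_measurableE.
  + exact: measurable_funTS.
Qed.

End Version.

Lemma cond_prob_unique (F : set (set Omega)) (E : set Omega) (u v : Omega -> R) :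
  sub_sigma F -> is_cond_prob P F E u -> is_cond_prob P F E v ->
  {ae P, forall w, u w = v w}.
Proof.
move=> sF [mu iu uE] [mv _ vE]; apply: (coarse_ae_eq sF) => // C FC.
by rewrite uE// vE.
Qed.

Lemma integral_ae_congr (C : set Omega) (u v : Omega -> R) :
  measurable C -> measurable_fun setT u -> measurable_fun setT v ->
  {ae P, forall w, u w = v w} ->
  (\int[P]_(w in C) (u w)%:E = \int[P]_(w in C) (v w)%:E)%E.
Proof.
move=> mC mu mv uv; apply: ae_eq_integral => //.
- by apply: measurable_funTS; exact/measurable_EFinP.
- by apply: measurable_funTS; exact/measurable_EFinP.
- by apply: filterS uv => w -> _.
Qed.

(** Measurability comes from the smaller [F], the integral identity from the larger [H].
    Decomposition and weak union reduce to this. *)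
Lemma is_cond_prob_sandwich (F F' H : set (set Omega)) (E : set Omega)
    (g : Omega -> R) :
  F `<=` F' -> F' `<=` H ->
  is_cond_prob P F E g -> is_cond_prob P H E g -> is_cond_prob P F' E g.
Proof.
move=> FF' F'H [mg ig _] [_ _ gE]; split => //.
- by move=> B mB; apply: FF'; exact: mg.
- by move=> C /F'H; exact: gE.
Qed.

End CondProb.

Section DensityMeasure.
Context {d : measure_display} {Omega : measurableType d} {R : realType}.
Variables (mu : {measure set Omega -> \bar R}) (f : Omega -> \bar R).
Hypotheses (mf : measurable_fun setT f) (f0 : forall w, (0 <= f w)%E).

Definition density (K : set Omega) : \bar R := (\int[mu]_(w in K) f w)%E.

Let density0 : density set0 = 0%E.
Proof. exact: integral_set0. Qed.

Let density_ge0 K : (0 <= density K)%E.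
Proof. by apply: integral_ge0 => w _; exact: f0. Qed.

HB.instance Definition _ := isMeasure.Build _ _ _ density
  density0 density_ge0 (semi_sigma_additive_nng_induced mf f0).

Definition density_measure : {measure set Omega -> \bar R} := density.

End DensityMeasure.

(** * Conditional independence as screening *)

Section Screening.
Context {d : measure_display} {Omega : measurableType d} {R : realType}.
Variable P : probability Omega R.
Implicit Types F H : set (set Omega).

Lemma sub_sigmaT F : sub_sigma F -> F setT.
Proof. by move=> [[F0 FD _] _]; rewrite -(setD0 setT); exact: FD. Qed.

Lemma sub_sigmaI F A B : sub_sigma F -> F A -> F B -> F (A `&` B).
Proof.
move=> sF; rewrite -!(coarse_measurableE sF); exact: measurableI.
Qed.

Lemma sub_sigma_generated (G : set (set Omega)) :
  G `<=` measurable -> sub_sigma <<s G >>.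
Proof.
move=> mG; split; first exact: smallest_sigma_algebra.
by apply: smallest_sub => //; exact: sigma_algebra_measurable.
Qed.

(** For [F] inside [H]: the events of [H] add nothing to what [F] tells about [F1]. One function
    must be a version for both, so no almost sure equality enters. *)
Definition screened F1 F H : Prop := forall E, F1 E ->
  exists2 g, is_cond_prob P F E g & is_cond_prob P H E g.

Variables F1 F2 F : set (set Omega).
Hypotheses (sF1 : sub_sigma F1) (sF2 : sub_sigma F2) (sF : sub_sigma F).

Lemma sub_sigma_join : sub_sigma <<s F `|` F2 >>.
Proof. by apply: sub_sigma_generated => A [/sF.2|/sF2.2]. Qed.

(** From left to right, the pull-out property and the product formula give the integral identity on
    intersections of a set of [F] with a set of [F2]. These form a pi-system generating the join,
    and uniqueness of finite measures does the rest. From right to left, the integral of the product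
    over [C] is that of one factor over the intersection of [E2] and [C], a set of the join, where
    screening evaluates it. *)
Lemma sigma_cond_indep_screened :
  sigma_cond_indep P F1 F2 F <-> screened F1 F <<s F `|` F2 >>.
Proof.
split=> [ci E F1E|sc E1 E2 g1 g2 g12 F1E F2E c1 c2 c12].
- have mE := sF1.2 _ F1E.
  have [g [cg g0 pull]] := cond_prob_exists P sF mE.
  have mg := cg; case: mg => mg ig gE.
  exists g => //; split => //.
    by move=> B mB; apply: sub_sigma_algebra; left; exact: mg.
  have mgT := coarse_measurableW sF mg.
  pose m1 := density_measure P (f := EFin \o g)
    ((measurable_EFinP _ _).2 mgT) (fun w => g0 w).
  pose m2 : {measure set Omega -> \bar R} := mrestr P mE.
  pose G := [set K | exists C A, [/\ F C, F2 A & K = C `&` A]].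
  have Gm : G `<=` measurable.
    by move=> _ [C [A [FC FA ->]]]; apply: measurableI; [exact: sF.2|exact: sF2.2].
  have GI : setI_closed G.
    move=> _ _ [C [A [FC FA ->]]] [C' [A' [FC' FA' ->]]].
    exists (C `&` C'), (A `&` A'); split; [exact: sub_sigmaI..|].
    by rewrite setIACA.
  have sub : <<s F `|` F2 >> `<=` <<s G >>.
    apply: smallest_sub; first exact: smallest_sigma_algebra.
    move=> K [FK|FK]; apply: sub_sigma_algebra.
    + by exists K, setT; split; rewrite ?setIT//; exact: sub_sigmaT.
    + by exists setT, K; split; rewrite ?setTI//; exact: sub_sigmaT.
  move=> K /sub GK.
  have GT : G setT.
    by exists setT, setT; split; rewrite ?setIT//; exact: sub_sigmaT.
  have -> : P (E `&` K) = m2 K by rewrite setIC.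
  have -> : (\int[P]_(w in K) (g w)%:E)%E = m1 K by [].
  apply: (g_sigma_algebra_measure_unique G Gm (fun=> setT)) => //.
  + exact: bigcup_const.
  + move=> _ [C [A [FC FA ->]]].
    have mA := sF2.2 _ FA; have mC := sF.2 _ FC.
    have [g2 [cg2 g20 pull2]] := cond_prob_exists P sF mA.
    have [g12 [cg12 _ _]] := cond_prob_exists P sF (measurableI _ _ mE mA).
    have := ci _ _ _ _ _ F1E FA cg cg2 cg12.
    case: cg2 cg12 => mg2 _ _ [mg12 _ g12E] gg.
    transitivity (\int[P]_(w in A `&` C) (g w)%:E)%E; first by rewrite setIC.
    rewrite -pull2//.
    rewrite -(integral_ae_congr _ _ _ gg)//; last 2 first.
    * exact: (coarse_measurableW sF).
    * by apply: measurable_funM => //; exact: (coarse_measurableW sF).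
    rewrite g12E//; congr (P _).
    by rewrite -setIA setIC [C `&` A]setIC.
  + move=> _; rewrite /m1 /=.
    have -> : density P (EFin \o g) setT = P (E `&` setT).
      by apply: gE; exact: sub_sigmaT.
    by rewrite setIT (le_lt_trans (probability_le1 P mE))// ltry.
- have mE1 := sF1.2 _ F1E; have mE2 := sF2.2 _ F2E.
  (* The given versions may be negative on a null set; pull-out needs nonnegative ones. *)
  have [h1 [ch1 h10 _]] := cond_prob_exists P sF mE1.
  have [h2 [ch2 h20 pull]] := cond_prob_exists P sF mE2.
  have [g cg cgH] := sc _ F1E.
  have e1 := cond_prob_unique sF c1 ch1.
  have e2 := cond_prob_unique sF c2 ch2.
  have eg := cond_prob_unique sF ch1 cg.
  have [mh1 _ _] := ch1; have [mh2 _ _] := ch2.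
  have [mg _ _] := cg; have [_ _ gE] := cgH; have [m12 i12 E12] := c12.
  suff : {ae P, forall w, g12 w = h1 w * h2 w}.
    by move=> e12; apply: filterS3 e12 e1 e2 => w -> -> ->.
  apply: (coarse_ae_eq sF) => //.
    apply/measurable_fun_coarse => //; apply: measurable_funM;
      exact/measurable_fun_coarse.
  move=> C FC; have mC := sF.2 _ FC; rewrite E12// pull//.
  rewrite (integral_ae_congr _ _ _ eg); last 3 first.
  + exact: measurableI.
  + exact: (coarse_measurableW sF).
  + exact: (coarse_measurableW sF).
  rewrite gE ?setIA//; apply: (sub_sigmaI sub_sigma_join).
  + by apply: sub_sigma_algebra; right.
  + by apply: sub_sigma_algebra; left.
Qed.

End Screening.

(** * Semigraphoid rules for random vectors *)

Section Semigraphoid.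
Context {d : measure_display} {Omega : measurableType d} {R : realType}.
Variable P : probability Omega R.
Context {p : nat} {d' : 'I_p -> measure_display}
  {T : forall k, measurableType (d' k)}.
Variable X : forall k, {RV P >-> T k}.
Implicit Types A B C D : {set 'I_p}.

Lemma sub_sigma_of A : sub_sigma (sigma_of X A).
Proof.
apply: sub_sigma_generated => _ [k _ [B mB <-]].
exact: (measurable_funPT (X k)).
Qed.

Lemma sigma_ofS A B : A \subset B -> sigma_of X A `<=` sigma_of X B.
Proof.
move=> /fintype.subsetP AB; apply: sub_sigma_algebra2.
by move=> K [k /= kA XK]; exists k => //=; exact: AB.
Qed.

Lemma sigma_ofU A B :
  <<s sigma_of X A `|` sigma_of X B >> = sigma_of X (B :|: A)%SET.
Proof.
apply/seteqP; split; apply: smallest_sub; try exact: smallest_sigma_algebra.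
  by move=> K [|]; apply: sigma_ofS; rewrite (finset.subsetUl, finset.subsetUr).
move=> K [k /=]; rewrite inE => /orP[kB|kA] XK; apply: sub_sigma_algebra.
  by right; apply: sub_sigma_algebra; exists k.
by left; apply: sub_sigma_algebra; exists k.
Qed.

Lemma cond_indepE A B C : cond_indep X A B C <->
  screened P (sigma_of X A) (sigma_of X C) (sigma_of X (B :|: C)%SET).
Proof.
by rewrite -sigma_ofU; apply: sigma_cond_indep_screened; exact: sub_sigma_of.
Qed.

(** Symmetry is read off the product formula; the screened form hides it. *)
Lemma cond_indepC A B C : cond_indep X A B C -> cond_indep X B A C.
Proof.
move=> ci E1 E2 g1 g2 g12 F1 F2 c1 c2 c12.
rewrite setIC in c12.
by have := ci _ _ _ _ _ F2 F1 c2 c1 c12; apply: filterS => w ->; rewrite mulrC.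
Qed.

(** Decomposition; since [B'] may meet [C], conditioning variables can be added or dropped
    freely. *)
Lemma cond_indepS A B B' C : B' \subset (B :|: C)%SET ->
  cond_indep X A B C -> cond_indep X A B' C.
Proof.
move=> sB /cond_indepE sc; apply/cond_indepE => E /sc[g cg cgH].
exists g => //; apply: is_cond_prob_sandwich cg cgH; apply: sigma_ofS.
  exact: finset.subsetUr.
by rewrite finset.subUset sB finset.subsetUr.
Qed.

(** Weak union with [B] kept whole: enlarging [C] inside the union of [B] and [C] leaves that union
    unchanged. *)
Lemma cond_indep_weak_union A B C C' : C \subset C' -> C' \subset (B :|: C)%SET ->
  cond_indep X A B C -> cond_indep X A B C'.
Proof.
move=> sC sC' /cond_indepE sc; apply/cond_indepE => E /sc[g cg cgH].
have <- : (B :|: C)%SET = (B :|: C')%SET.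
  apply/eqP; rewrite finset.eqEsubset finset.setUS//=.
  by rewrite finset.subUset finset.subsetUl.
by exists g => //; apply: is_cond_prob_sandwich cg cgH; exact: sigma_ofS.
Qed.

(** The version [g] that works given [C] also works given [B] and [C], where it agrees almost surely
    with [h], which works given [B], [C] and [D]. Hence [g] has the right integrals there too. *)
Lemma cond_indep_contraction A B C D :
  cond_indep X A B C -> cond_indep X A D (B :|: C)%SET ->
  cond_indep X A (B :|: D)%SET C.
Proof.
move=> /cond_indepE sc1 /cond_indepE sc2; apply/cond_indepE => E FE.
have [g cg cgH] := sc1 _ FE; have [h ch [mh ih hE]] := sc2 _ FE.
have sH := sub_sigma_of (B :|: C)%SET.
have gh := cond_prob_unique sH cgH ch.
have [mg ig _] := cg.
exists g => //; rewrite finset.setUAC finset.setUC; split => //.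
  move=> K /mg; apply: sigma_ofS.
  by rewrite finset.setUA finset.subsetUr.
move=> K FK; rewrite -hE//; apply: integral_ae_congr => //.
- exact: (sub_sigma_of _).2 FK.
- exact: (coarse_measurableW (sub_sigma_of C)).
- exact: (coarse_measurableW (sub_sigma_of (D :|: (B :|: C))%SET)).
Qed.

Lemma local_markovE (G : rel 'I_p) :
  local_markov X G <-> forall i, cond_indep X [set i]%SET (nd G i) (pa G i).
Proof.
split=> lm i; apply: cond_indepS (lm i).
  apply/fintype.subsetP => k kn; rewrite !inE; move: kn; rewrite inE => ->.
  by rewrite andbT orNb.
by rewrite finset.subDset finset.setUCA finset.subsetUl.
Qed.

End Semigraphoid.

End SigmaAlgebras.

(** * Reversing an edge of a DAG *)

Section Dags.
Variable p : nat.
Implicit Types (G H : rel 'I_p) (i j k u : 'I_p).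

Lemma dag_edge_connectF G u k : is_dag G -> G u k -> ~~ connect G k u.
Proof.
move=> dG uk; apply/negP => /connectP[s ks us].
have : cycle G (k :: s) by rewrite /cycle rcons_path ks -us.
by move/dG.
Qed.

Lemma dag_irr G k : is_dag G -> G k k = false.
Proof.
move=> dG; apply/negP => kk.
by have := dag_edge_connectF dG kk; rewrite connect0.
Qed.

Lemma dag_no_triangle G a b c :
  is_dag G -> G a b -> G b c -> G c a = false.
Proof.
move=> dG ab bc; apply/negP => ca; have := dag_edge_connectF dG ca.
by rewrite (connect_trans (connect1 ab) (connect1 bc)).
Qed.

Lemma dag_connect_antisym G u k :
  is_dag G -> connect G u k -> connect G k u -> u = k.
Proof.
move=> dG /connectP[[|v s] /=]; first by move=> _ ->.
move=> /andP[uv vs] kE ku; have := dag_edge_connectF dG uv.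
by rewrite (connect_trans _ ku)//; apply/connectP; exists s.
Qed.

Lemma connect_ind_r G u (Q : 'I_p -> Prop) : Q u ->
  (forall a b, connect G u a -> Q a -> G a b -> Q b) ->
  forall k, connect G u k -> Q k.
Proof.
move=> Qu QS k /connectP[s]; elim/last_ind: s k => [k _ ->//|s v IH k].
rewrite rcons_path last_rcons => /andP[us sv] ->.
apply: QS sv; last exact: IH.
by apply/connectP; exists s.
Qed.

(** A member [k] with the fewest ancestors will do: a parent of [k] in [A] would have strictly
    fewer, as [k] is not among them. *)
Lemma dag_source G (A : {set 'I_p}) : is_dag G -> A != finset.set0 ->
  exists2 k, k \in A & forall u, u \in A -> ~~ G u k.
Proof.
move=> dG /set0Pn[k0 k0A].
pose m k := #|[set a | connect G a k]%SET|.
case: (arg_minnP m k0A) => k kA kmin.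
exists k => // u uA; apply/negP => uk.
have := kmin _ uA; rewrite leqNgt => /negP; apply.
apply: proper_card; apply/properP; split.
  apply/fintype.subsetP => a; rewrite !inE => au.
  exact: connect_trans au (connect1 uk).
exists k; first by rewrite inE connect0.
by rewrite inE (dag_edge_connectF dG).
Qed.

End Dags.

(** * Parents and paths under an edge reversal *)

Section Reversal.
Variable p : nat.
Variables (G : rel 'I_p) (i j : 'I_p).
Local Notation H := (reverse_edge G i j).
Hypotheses (dG : is_dag G) (dH : is_dag H) (Gij : G i j).

Lemma reverse_edge_neq : i != j.
Proof.
by apply/eqP => ij; have := dag_edge_connectF dG Gij; rewrite ij connect0.
Qed.

Lemma reverse_edge_ji : H j i.
Proof. by rewrite /reverse_edge !eqxx. Qed.

Lemma dag_edge_asym : G j i = false.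
Proof.
by apply/negP => Gji; have := dag_edge_connectF dG Gij; rewrite connect1.
Qed.

(** Reversal is undone by reversing back, so facts about [G] and [H] transfer with the roles
    exchanged. *)
Lemma reverse_edgeK : reverse_edge H j i = G.
Proof.
apply/funext => a; apply/funext => b; rewrite /reverse_edge.
have [/andP[/eqP -> /eqP ->]|_] := boolP ((a == i) && (b == j)); first by rewrite Gij.
have [/andP[/eqP -> /eqP ->]|_] := boolP ((a == j) && (b == i)).
  by rewrite dag_edge_asym andbF.
by rewrite !andbT.
Qed.

Lemma pa_reverse_edge_i : pa H i = (j |: pa G i)%SET.
Proof.
apply/setP => a; rewrite !inE /reverse_edge eqxx andbT.
by rewrite (negbTE reverse_edge_neq) andbF andbT.
Qed.

Lemma pa_reverse_edge_j : pa H j = (pa G j :\ i)%SET.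
Proof.
apply/setP => a; rewrite !inE /reverse_edge eqxx andbT.
by rewrite [j == i]eq_sym (negbTE reverse_edge_neq) andbF /= andbC.
Qed.

Lemma pa_reverse_edge k : k != i -> k != j -> pa H k = pa G k.
Proof.
move=> ki kj; apply/setP => a; rewrite !inE /reverse_edge.
by rewrite (negbTE ki) (negbTE kj) !andbF /= andbT.
Qed.

(** Only the edge from [i] to [j] is lost. A path that would use it reaches [i] in [H] through some
    [w]: either [w] is [j], or [w] is a parent of [i], hence of [j], and leads to [j] directly. *)
Lemma connect_reverse_edge k u : k != i -> pa G i \subset pa G j ->
  connect G k u -> connect H k u.
Proof.
move=> ki sub; move: u; apply: connect_ind_r => [|a b _ ka Gab].
  exact: connect0.
have [/andP[/eqP ai /eqP bj]|nij] := boolP ((a == i) && (b == j)); last first.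
  by apply: connect_trans ka (connect1 _); rewrite /reverse_edge Gab nij orbT.
rewrite ai in ka; rewrite bj; move: ka => /connectP[s].
case/lastP: s => [_ ik|s v]; first by rewrite ik eqxx in ki.
rewrite rcons_path last_rcons => /andP[ks lv] iv; subst v.
have kl : connect H k (last k s) by apply/connectP; exists s.
move: (last k s) lv kl => w; rewrite /reverse_edge eqxx andbT.
case/orP => [/eqP -> //|/andP[Gwi _] kl].
apply: connect_trans kl (connect1 _); rewrite /reverse_edge.
have : w \in pa G i by rewrite inE.
move=> /(fintype.subsetP sub); rewrite inE => ->/=.
apply/orP; right; rewrite eqxx andbT; apply/eqP => wi.
by have := dag_edge_connectF dG Gwi; rewrite wi connect0.
Qed.

(** Start with the new edge from [j] to [i]; where the path used the old edge, restart at [j]. *)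
Lemma connect_reverse_edge_tail u : connect G i u -> connect H j u.
Proof.
move: u; apply: connect_ind_r => [|a b _ ja Gab].
  exact: connect1 reverse_edge_ji.
have [/andP[_ /eqP ->]|nij] := boolP ((a == i) && (b == j)).
  exact: connect0.
by apply: connect_trans ja (connect1 _); rewrite /reverse_edge Gab nij orbT.
Qed.

End Reversal.

Lemma ndP p (G : rel 'I_p) i k :
  reflect (k <> i /\ ~ connect G i k) (k \in nd G i).
Proof.
rewrite inE; apply: (iffP andP) => -[a b]; split; try exact/eqP; exact/negP.
Qed.

(** * Local Markov property across a covered edge *)

Section Covered.
Variable p : nat.
Variables (G : rel 'I_p) (i j : 'I_p).
Local Notation H := (reverse_edge G i j).
Hypotheses (dG : is_dag G) (dH : is_dag H) (Gij : G i j).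
Hypothesis cov : pa G j = (i |: pa G i)%SET.

Let neq_ij := reverse_edge_neq dG Gij.
Let Hji : H j i := reverse_edge_ji G i j.

Lemma covered_sub : pa G i \subset pa G j.
Proof. by rewrite cov finset.subsetUr. Qed.

Lemma covered_pa_j : pa H j = pa G i.
Proof.
rewrite pa_reverse_edge_j// cov setU1K// inE; apply/negP => Gii.
by have := dag_edge_connectF dG Gii; rewrite connect0.
Qed.

Lemma covered_pa_i : pa H i = (j |: pa G i)%SET.
Proof. exact: pa_reverse_edge_i. Qed.

Lemma covered_connect k u : k != i -> connect G k u -> connect H k u.
Proof. by move=> ki; apply: connect_reverse_edge => //; exact: covered_sub. Qed.

Lemma covered_connectV k u : k != j -> connect H k u -> connect G k u.
Proof.
move=> kj; rewrite -[in connect G _ _](reverse_edgeK dG Gij).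
apply: connect_reverse_edge => //.
by rewrite covered_pa_i covered_pa_j finset.subsetUr.
Qed.

Lemma covered_connect_tailV u : connect H j u -> connect G i u.
Proof.
by move=> /(connect_reverse_edge_tail i); rewrite reverse_edgeK.
Qed.

Lemma covered_nd k : k != i -> k != j -> nd H k = nd G k.
Proof.
move=> ki kj; apply/setP => u; rewrite !inE; congr (_ && ~~ _).
by apply/idP/idP; [exact: covered_connectV|exact: covered_connect].
Qed.

Context (R : realType) {d : measure_display} {Omega : measurableType d}.
Variable P : probability Omega R.
Context {d' : 'I_p -> measure_display} {T : forall k, measurableType (d' k)}.
Variable X : forall k, {RV P >-> T k}.
Hypothesis lm : local_markov X G.

(** The non-descendants of [j] in [H] are non-descendants of both [i] and [j] in [G]; contraction
    joins the two local statements, as [pa G j] is [pa G i] with [i] added. *)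
Lemma covered_indep_pair :
  cond_indep X (nd H j) [set i; j]%SET (pa G i).
Proof.
have /local_markovE lci := lm.
have ndi : nd H j \subset nd G i.
  apply/fintype.subsetP => u /ndP[uj ju]; apply/ndP; split.
    by move=> ui; apply: ju; rewrite ui connect1.
  by move=> iu; apply: ju; exact: connect_reverse_edge_tail.
have ndj : nd H j \subset nd G j.
  apply/fintype.subsetP => u /ndP[uj ju]; apply/ndP; split => // ju'.
  by apply: ju; apply: covered_connect ju'; rewrite eq_sym.
apply: cond_indep_contraction; apply: cond_indepC.
  apply: cond_indepS (lci i).
  exact: fintype.subset_trans ndi (finset.subsetUl _ _).
rewrite -cov.
apply: cond_indepS (lci j).
exact: fintype.subset_trans ndj (finset.subsetUl _ _).
Qed.

Definition ancestral (U : {set 'I_p}) : Prop :=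
  forall u, u \in U -> pa H u \subset U.

Lemma ancestralP (U : {set 'I_p}) a u :
  ancestral U -> connect H a u -> u \in U -> a \in U.
Proof.
move=> aU /connectP[s]; elim: s a => [a _ ->//|v s IH a /= /andP[av vs] ul uU].
have vU := IH _ vs ul uU.
by apply: (fintype.subsetP (aU _ vU)); rewrite inE.
Qed.

Lemma ancestral_nd k : pa H k \subset nd H k -> ancestral (nd H k).
Proof.
move=> pak u /ndP[uk ku]; apply/fintype.subsetP => a; rewrite inE => au.
have nka : ~ connect H k a.
  by move=> ka; apply: ku; exact: connect_trans ka (connect1 au).
apply/ndP; split => // ak; apply: nka; rewrite ak; exact: connect0.
Qed.

Lemma pa_nd k : pa H k \subset nd H k.
Proof.
apply/fintype.subsetP => a; rewrite inE => ak.
have nka : ~ connect H k a by apply/negP; exact: dag_edge_connectF.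
by apply/ndP; split => // akE; apply: nka; rewrite akE; exact: connect0.
Qed.

Lemma nd_sub : (j |: nd H j)%SET \subset nd H i.
Proof.
have nij : ~ connect H i j by apply/negP; exact: dag_edge_connectF.
rewrite finset.subUset finset.sub1set; apply/andP; split.
  by apply/ndP; split => //; apply/eqP; rewrite eq_sym.
apply/fintype.subsetP => u /ndP[uj ju]; apply/ndP; split.
  by move=> ui; apply: ju; rewrite ui connect1.
by move=> iu; apply: ju; exact: connect_trans (connect1 Hji) iu.
Qed.

(** Induction on the number of nodes of [nd H i] outside [U]: a source [k] of the difference
    satisfies [k _||_ i | U] by its local property in [G], and contraction adds it to [U]. *)
Lemma covered_indep_extend (U : {set 'I_p}) : ancestral U ->
  (j |: nd H j)%SET \subset U -> U \subset nd H i ->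
  cond_indep X [set i]%SET U (j |: pa G i)%SET ->
  cond_indep X [set i]%SET (nd H i) (j |: pa G i)%SET.
Proof.
have /local_markovE lci := lm.
have [n] := ubnP #|nd H i :\: U|%SET; elim: n U => // n IH U Un aU sU Ui ci.
have [UE|U0] := eqVneq (nd H i :\: U)%SET finset.set0.
  suff -> : nd H i = U by [].
  by apply/eqP; rewrite finset.eqEsubset Ui andbT -finset.setD_eq0 UE.
have [k] := dag_source dH U0; rewrite finset.inE => /andP[kU ki] ksrc.
have paU : pa H k \subset U.
  apply/fintype.subsetP => a ak; apply: contraT => aU'.
  have := ksrc a; rewrite finset.inE aU'/=.
  have -> : a \in nd H i.
    by apply: (fintype.subsetP (ancestral_nd (pa_nd i) ki)).
  by move=> /(_ isT); rewrite inE in ak; rewrite ak.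
have jU : j \in U by apply: (fintype.subsetP sU); rewrite !inE eqxx.
have kj : k != j by apply: contraNneq kU => ->.
have /ndP[/eqP ki' _] := ki.
(* Outside [nd H j], so below [j] in [H] and therefore below [i] in [G]; by acyclicity [i] is no
   descendant of [k] in [G]. *)
have jk : connect H j k.
  apply: contraT => njk; case/negP: kU; apply: (fintype.subsetP sU).
  by rewrite !inE (negbTE kj) /= njk.
have ndk : (i |: U)%SET \subset nd G k.
  rewrite finset.subUset finset.sub1set; apply/andP; split.
    apply/ndP; split; first by apply/eqP; rewrite eq_sym.
    move=> Gki; have ik := covered_connect_tailV jk.
    by move/eqP: ki'; apply; exact: dag_connect_antisym dG Gki ik.
  apply/fintype.subsetP => u uU; apply/ndP; split.
    by move=> uk; rewrite -uk uU in kU.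
  move=> /(covered_connect ki') ku.
  by rewrite (ancestralP aU ku uU) in kU.
apply: (IH (U :|: [set k])%SET).
- rewrite ltnS in Un; apply: leq_trans Un; apply: proper_card.
  apply/properP; split; first by apply: finset.setDS; exact: finset.subsetUl.
  exists k; rewrite finset.in_setD ?finset.in_setU ?finset.in_set1 ?eqxx ?orbT//.
  by rewrite kU ki.
- move=> u; rewrite !finset.inE => /orP[uU|/eqP ->].
    exact: fintype.subset_trans (aU _ uU) (finset.subsetUl _ _).
  exact: fintype.subset_trans paU (finset.subsetUl _ _).
- exact: fintype.subset_trans sU (finset.subsetUl _ _).
- by rewrite finset.subUset Ui finset.sub1set.
- apply: cond_indep_contraction ci _.
  (* The conditioning set is already contained in [U], so contraction asks for independence given
     [U] alone. *)
  have -> : (U :|: (j |: pa G i) = U)%SET.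
    apply/finset.setUidPl; rewrite finset.subUset finset.sub1set jU/=.
    apply: fintype.subset_trans sU; rewrite -covered_pa_j.
    by apply: fintype.subset_trans (pa_nd j) (finset.subsetUr _ _).
  apply: cond_indepC.
  have sUn : U \subset nd G k.
    exact: fintype.subset_trans (finset.subsetUr _ _) ndk.
  apply: (@cond_indepS _ _ _ _ _ _ _ _ _ (nd G k)).
    apply: fintype.subset_trans (finset.subsetUl _ _).
    exact: fintype.subset_trans (finset.subsetUl _ _) ndk.
  apply: cond_indep_weak_union (lci k).
    by rewrite -(pa_reverse_edge G ki' kj).
  exact: fintype.subset_trans sUn (finset.subsetUl _ _).
Qed.

(** The statement for [j] is part of the pair statement. For [i], weak union moves [j] into the
    condition, which starts the extension at [j |: nd H j]. All other nodes keep their parents and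
    non-descendants. *)
Lemma covered_local_markov : local_markov X H.
Proof.
apply/local_markovE => k.
have pair := covered_indep_pair.
have paj : pa G i \subset nd H j by rewrite -covered_pa_j; exact: pa_nd.
have [->|ki] := eqVneq k i.
  rewrite covered_pa_i; apply: (covered_indep_extend (U := (j |: nd H j)%SET)) => //.
  - move=> u; rewrite !finset.inE => /orP[/eqP ->|uN].
      by rewrite covered_pa_j; apply: fintype.subset_trans paj (finset.subsetUr _ _).
    by apply: fintype.subset_trans (ancestral_nd (pa_nd j) _) (finset.subsetUr _ _);
      rewrite ?inE.
  - exact: nd_sub.
  - apply: (@cond_indepS _ _ _ _ _ _ _ _ _ (nd H j)).
      rewrite finset.subUset finset.subsetUl finset.sub1set !finset.inE eqxx.
      by rewrite orbT.
    apply: cond_indepC.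
    apply: (@cond_indepS _ _ _ _ _ _ _ _ _ [set i; j]%SET).
      by rewrite finset.sub1set !finset.inE eqxx.
    apply: cond_indep_weak_union pair; first exact: finset.subsetUr.
    by apply: finset.setSU; rewrite finset.sub1set !finset.inE eqxx orbT.
have [->|kj] := eqVneq k j.
  rewrite covered_pa_j; apply: cond_indepC; apply: cond_indepS pair.
  by rewrite finset.sub1set !finset.inE eqxx orbT.
rewrite covered_nd// pa_reverse_edge//.
by have /local_markovE := lm; exact.
Qed.

End Covered.

(** * Characteristic imsets *)

(** Both graphs have the same random vectors as models; the converse direction uses that the
    reversed edge is covered in [H]. *)
Lemma covered_markov_equiv (R : realType) p (G : rel 'I_p) (i j : 'I_p) :
  is_dag G -> is_dag (reverse_edge G i j) -> G i j ->
  pa G j = (i |: pa G i)%SET -> markov_equiv R G (reverse_edge G i j).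
Proof.
move=> dG dH Gij cov A B C; have GK := reverse_edgeK dG Gij.
split=> -[dAB dAC dBC enc]; split=> // d Omega P d' T X lm; apply: enc.
  rewrite -GK; apply: covered_local_markov lm => //.
  - by rewrite GK.
  - exact: reverse_edge_ji.
  - by rewrite covered_pa_i// covered_pa_j.
exact: covered_local_markov lm.
Qed.

Lemma sum_indicator (R : realType) (I : finType) (Q : {set I}) (x : I) :
  \sum_(y in Q) (x == y)%:R = (x \in Q)%:R :> R.
Proof.
rewrite big_mkcond (bigD1 x)//= eqxx big1 ?addr0; first by case: ifP.
by move=> y yx; rewrite eq_sym (negbTE yx) if_same.
Qed.

(** The common shape of [turn_plus] and [turn_minus]: as [Q] avoids [D], the set [T] is recovered by
    removing [D]. *)
Lemma mem_imset_setU (I : finType) (D Q M S : {set I}) : Q \subset (~: D)%SET ->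
  (S \in [set (T :|: D) | T : {set I}
    in [pred T : {set I} | (T \subset Q) && ~~ (T \subset M)]]%SET) =
  [&& D \subset S, (S :\: D)%SET \subset Q & ~~ ((S :\: D)%SET \subset M)].
Proof.
move=> QD; apply/imsetP/and3P => [[T]|[DS SQ SM]]; last first.
  exists (S :\: D)%SET; first by rewrite inE SQ.
  apply/setP => x; rewrite !inE.
  case: (boolP (x \in D)) => [/(fintype.subsetP DS) ->|_] //.
  by rewrite orbF.
rewrite inE => /andP[TQ TM] ->.
have -> : ((T :|: D) :\: D = T)%SET.
  rewrite finset.setDUl finset.setDv finset.setU0; apply/finset.setDidPl.
  by rewrite finset.disjoints_subset; exact: fintype.subset_trans TQ QD.
by rewrite finset.subsetUr.
Qed.

Section Imset.
Variables (R : realType) (p : nat).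
Implicit Types (G : rel 'I_p) (S : {set 'I_p}).

Definition has_sink G S : bool := [exists k in S, (S :\ k)%SET \subset pa G k].

Lemma char_imsetE G (A : imset_index p) :
  char_imset R G A = (has_sink G (val A))%:R.
Proof.
rewrite ffunE /has_sink; congr (_%:R); congr (nat_of_bool _).
by apply: eq_existsb => k; congr (_ && _); apply/forall_inP/fintype.subsetP.
Qed.

Lemma imset_coordE G S : (1 < #|S|)%N ->
  imset_coord (char_imset R G) S = (has_sink G S)%:R.
Proof. by move=> S1; rewrite /imset_coord insubT/= char_imsetE. Qed.

(** The three conditions of a turn pair that ask for coordinate 1 all have this form. The first two
    hypotheses keep the set above size 1, away from the default value 0. *)
Lemma imset_coord_sink G S k : k \notin S -> (0 < #|S|)%N -> S \subset pa G k ->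
  imset_coord (char_imset R G) (S :|: [set k])%SET = 1.
Proof.
move=> kS S0 Sk; rewrite imset_coordE; last first.
  by rewrite finset.setUC cardsU1 kS add1n ltnS.
rewrite (_ : has_sink _ _ = true)//; apply/existsP; exists k.
by rewrite finset.setUC setU1K// Sk !inE eqxx.
Qed.

End Imset.

(** * The turn pair of an edge that is not covered *)

Section TurnPair.
Variables (R : realType) (p : nat) (G : rel 'I_p) (i j : 'I_p).
Local Notation H := (reverse_edge G i j).
Hypotheses (dG : is_dag G) (dH : is_dag H) (Gij : G i j).

Let neq_ij := reverse_edge_neq dG Gij.
Let Si := pa G i.
Let Sj := (pa G j :\ i)%SET.

Lemma skeleton_reverse_edge : skeleton G =2 skeleton H.
Proof.
move=> a b; rewrite /skeleton /reverse_edge.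
rewrite [(b == j) && _]andbC [(b == i) && _]andbC.
have [/andP[/eqP -> /eqP ->]|_] := boolP ((a == i) && (b == j)).
  by rewrite Gij orbT.
have [/andP[/eqP -> /eqP ->]|_] := boolP ((a == j) && (b == i)).
  by rewrite Gij orbT.
by rewrite !andbT.
Qed.

Lemma Si_sub : Si \subset (~: [set i; j])%SET.
Proof.
apply/fintype.subsetP => a; rewrite !inE => ai; apply/norP; split.
  by apply/eqP => E; move: ai; rewrite E dag_irr.
by apply/eqP => E; move: ai; rewrite E (dag_edge_asym dG Gij).
Qed.

Lemma Sj_sub : Sj \subset (~: [set i; j])%SET.
Proof.
apply/fintype.subsetP => a; rewrite !inE => /andP[ai aj].
by rewrite (negbTE ai) /=; apply/eqP => E; move: aj; rewrite E dag_irr.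
Qed.

(** A parent of [i] cannot be a child of [j]: with the edge from [i] to [j] this would close a
    triangle in [G]. *)
Lemma Si_ne (T : {set 'I_p}) :
  T \subset Si -> (T \subset ne (skeleton G) j) = (T \subset Sj).
Proof.
move=> /fintype.subsetP Ti; apply/fintype.subsetP/fintype.subsetP => sub a aT.
  have := sub _ aT; have := Ti _ aT; rewrite !inE /skeleton => ai.
  rewrite (dag_no_triangle dG ai Gij) /= => ->; rewrite andbT.
  by apply/eqP => E; move: ai; rewrite E dag_irr.
by have := sub _ aT; rewrite !inE /skeleton => /andP[_ ->]; rewrite orbT.
Qed.

(** The same triangle argument, run in [H] with the edge from [j] to [i]. *)
Lemma Sj_ne (T : {set 'I_p}) :
  T \subset Sj -> (T \subset ne (skeleton G) i) = (T \subset Si).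
Proof.
move=> Tj; apply/fintype.subsetP/fintype.subsetP => sub a aT.
  have := sub _ aT; have := fintype.subsetP Tj _ aT.
  rewrite !inE skeleton_reverse_edge /skeleton => /andP[ai aj].
  have aij : a != j by apply/eqP => E; move: aj; rewrite E dag_irr.
  have Haj : H a j by rewrite /reverse_edge aj (negbTE ai) orbT.
  rewrite (dag_no_triangle dH Haj (reverse_edge_ji G i j)) /=.
  by rewrite /reverse_edge (negbTE aij) /= => /andP[].
by have := sub _ aT; rewrite !inE /skeleton => ->; rewrite orbT.
Qed.

Lemma sub_pa_reverse_edge (S : {set 'I_p}) k :
  k \in S -> ~~ ([set i; j] \subset S)%SET ->
  ((S :\ k)%SET \subset pa H k) = ((S :\ k)%SET \subset pa G k).
Proof.
move=> kS nS; have [E|ki] := eqVneq k i.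
  subst k; rewrite pa_reverse_edge_i//.
  have jS : j \notin S.
    by apply: contraNN nS => jS; rewrite finset.subUset !finset.sub1set kS.
  apply/idP/idP => /fintype.subsetP sub; apply/fintype.subsetP => a aS.
    have := sub _ aS; rewrite !inE => /orP[/eqP aj|//].
    by move: aS; rewrite aj !inE (negbTE jS) andbF.
  by move: (sub _ aS); rewrite !inE => ->; rewrite orbT.
have [E|kj] := eqVneq k j; last by rewrite pa_reverse_edge.
subst k; rewrite pa_reverse_edge_j//.
have iS : i \notin S.
  by apply: contraNN nS => iS; rewrite finset.subUset !finset.sub1set kS iS.
by rewrite finset.subsetD1 finset.in_setD1 (negbTE iS) andbF andbT.
Qed.

(** This is the imset identity at one coordinate, written additively in [nat] to avoid
    subtraction. *)
Lemma has_sink_reverse_edge (S : {set 'I_p}) :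
  (has_sink G S + (S \in turn_plus (skeleton G) i j Si) =
   has_sink H S + (S \in turn_minus (skeleton G) i j Sj))%N.
Proof.
rewrite /turn_plus /turn_minus (mem_imset_setU _ _ Si_sub) (mem_imset_setU _ _ Sj_sub).
have [ijS|nS] := boolP ([set i; j] \subset S)%SET; last first.
  rewrite /= !addn0; congr (nat_of_bool _); apply: eq_existsb => k.
  by case: (boolP (k \in S)) => //= kS; rewrite sub_pa_reverse_edge.
move: (ijS); rewrite finset.subUset !finset.sub1set => /andP[iS jS] /=.
set T := (S :\: [set i; j])%SET.
have -> : (T \subset Si) && ~~ (T \subset ne (skeleton G) j) =
    (T \subset Si) && ~~ (T \subset Sj).
  by case: (boolP (T \subset Si)) => //= /Si_ne ->.
have -> : (T \subset Sj) && ~~ (T \subset ne (skeleton G) i) =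
    (T \subset Sj) && ~~ (T \subset Si).
  by case: (boolP (T \subset Sj)) => //= /Sj_ne ->.
(* A sink in [T] has the same parents in both graphs. The only other possible sink is [j] in [G] and
   [i] in [H]. *)
pose b := [exists k in T, (S :\ k)%SET \subset pa G k].
have TjE : ((S :\ j)%SET \subset pa G j) = (T \subset Sj).
  rewrite /T /Sj; apply/idP/idP => /fintype.subsetP sub; apply/fintype.subsetP => a.
    rewrite !inE negb_or -andbA => /and3P[ai aj aS]; rewrite ai/=.
    by have := sub a; rewrite !inE aj aS => /(_ isT).
  rewrite !inE => /andP[aj aS]; have [->//|ai] := eqVneq a i.
  by have := sub a; rewrite !inE negb_or ai aj aS => /(_ isT).
have TiE : ((S :\ i)%SET \subset pa H i) = (T \subset Si).
  rewrite pa_reverse_edge_i// /T /Si.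
  apply/idP/idP => /fintype.subsetP sub; apply/fintype.subsetP => a.
    rewrite !inE negb_or -andbA => /and3P[ai aj aS].
    by have := sub a; rewrite !inE (negbTE aj) ai aS => /(_ isT).
  rewrite !inE => /andP[ai aS]; have [//|aj] := eqVneq a j.
  by have := sub a; rewrite !inE negb_or ai aj aS => /(_ isT).
have GE : has_sink G S = b || (T \subset Sj).
  apply/idP/idP.
    case/existsP => k /andP[kS kpa]; have [E|kj] := eqVneq k j.
      by move: kpa; rewrite E TjE => ->; rewrite orbT.
    have [E|ki] := eqVneq k i.
      have := fintype.subsetP kpa j; rewrite !inE E eq_sym neq_ij jS => /(_ isT).
      by rewrite (dag_edge_asym dG Gij).
    apply/orP; left; apply/existsP; exists k.
    by rewrite kpa !inE negb_or ki kj kS.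
  case/orP => [/existsP[k /andP[kT kpa]]|TS]; apply/existsP.
    by exists k; rewrite kpa; move: kT; rewrite !inE => /andP[_ ->].
  by exists j; rewrite jS TjE.
have HE : has_sink H S = b || (T \subset Si).
  apply/idP/idP.
    case/existsP => k /andP[kS kpa]; have [E|ki] := eqVneq k i.
      by move: kpa; rewrite E TiE => ->; rewrite orbT.
    have [E|kj] := eqVneq k j.
      have := fintype.subsetP kpa i; rewrite !inE E neq_ij iS => /(_ isT).
      by rewrite /reverse_edge (negbTE neq_ij) !eqxx /= andbF.
    apply/orP; left; apply/existsP; exists k.
    by rewrite -(pa_reverse_edge G ki kj) kpa !inE negb_or ki kj kS.
  case/orP => [/existsP[k /andP[kT kpa]]|TS]; apply/existsP.
    move: kT; rewrite !inE negb_or -andbA => /and3P[ki kj kS].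
    by exists k; rewrite kS pa_reverse_edge.
  by exists i; rewrite iS TiE.
(* A sink in [T] is a child of [i] and of [j], hence a parent of neither. *)
have bE : b -> ~~ (T \subset Si) /\ ~~ (T \subset Sj).
  case/existsP => k /andP[kT kpa]; have kT' := kT.
  move: kT'; rewrite !inE negb_or -andbA => /and3P[ki kj kS].
  have ik : G i k.
    by have := fintype.subsetP kpa i; rewrite !inE iS eq_sym ki => /(_ isT).
  have jk : G j k.
    by have := fintype.subsetP kpa j; rewrite !inE jS eq_sym kj => /(_ isT).
  split; apply/negP => /fintype.subsetP /(_ _ kT); rewrite !inE.
    by rewrite (dag_edge_asym dG ik).
  by rewrite (dag_edge_asym dG jk) andbF.
rewrite GE HE; have [/bE[/negbTE -> /negbTE ->] //|_] := boolP b.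
(* Without a sink in [T], both sides equal 1 exactly when [T] lies in [Si] or in [Sj]. *)
by case: (T \subset Si); case: (T \subset Sj).
Qed.

Lemma turn_pair_reverse_edge : pa G j <> (i |: pa G i)%SET ->
  turn_pair R G H.
Proof.
move=> ncov; split => //; first exact: skeleton_reverse_edge.
exists i, j, Si, Sj.
have nSi (k : 'I_p) (S : {set 'I_p}) : k \in [set i; j]%SET ->
    S \subset (~: [set i; j])%SET -> k \notin S.
  move=> kij /fintype.subsetP sub; apply/negP => /sub.
  by rewrite finset.in_setC kij.
split.
- by split; [exact: Si_sub|exact: Sj_sub].
- by apply: imset_coord_sink; rewrite ?cards1// !(inE, finset.sub1set)// eq_sym.
- split=> S sS S0; apply: imset_coord_sink => //.
  + apply: nSi; first by rewrite !inE eqxx.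
    exact: fintype.subset_trans sS Si_sub.
  + apply: nSi; first by rewrite !inE eqxx orbT.
    exact: fintype.subset_trans sS Sj_sub.
  + exact: fintype.subset_trans sS (finset.subsetDl _ _).
(* If both inclusions held, [Si] and [Sj] would coincide and the edge would be covered. *)
- apply/orP; rewrite -negb_and; apply/negP => /andP[].
  rewrite (Si_ne (fintype.subxx _)) (Sj_ne (fintype.subxx _)) => SiSj SjSi.
  apply: ncov; have -> : pa G i = Sj by apply/eqP; rewrite finset.eqEsubset SiSj.
  by rewrite finset.setD1K// inE.
- apply/ffunP => A; rewrite char_imsetE.
  rewrite [RHS]ffunE [X in X + _]ffunE [X in _ + X]ffunE.
  rewrite char_imsetE !sum_ffunE.
  under eq_bigr do rewrite ffunE.
  under [X in _ - X]eq_bigr do rewrite ffunE.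
  rewrite !sum_indicator; apply/eqP; rewrite eq_sym subr_eq -!natrD.
  by rewrite has_sink_reverse_edge.
Qed.

End TurnPair.

Theorem proposition3p2 (R : realType) (p : nat) (G : rel 'I_p) (i j : 'I_p)
    (hG : is_dag G) (hij : G i j) (hH : is_dag (reverse_edge G i j)) :
  markov_equiv R G (reverse_edge G i j) \/
  turn_pair R G (reverse_edge G i j).
Proof.
have [cov|ncov] := eqVneq (pa G j) (i |: pa G i)%SET.
  by left; exact: covered_markov_equiv.
by right; apply: turn_pair_reverse_edge => //; exact/eqP.
Qed.
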